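(* Let $m\ge 2$, let $G=D_{2^m}$ be the dihedral group of order $2^m$, let $J$ be the $\mathbb{Z}[G]$-module defined in the context (with $4n=2^m$), and let $k\ge 0$. Then an algebraic $2$-complex $X$ over $\mathbb{Z}[G]$ with $\pi_2(X)\cong J\oplus \mathbb{Z}[G]^k$ is uniquely determined up to chain homotopy equivalence; that is, any two algebraic $2$-complexes $X,Y$ over $\mathbb{Z}[G]$ with $\pi_2(X)\cong\pi_2(Y)\cong J\oplus\mathbb{Z}[G]^k$ are chain homotopy equivalent.
   Context: $D_{4n}$ (subscript = order) is the group with presentation $\langle a,b\mid a^{2n}=b^2=e,\ aba=b\rangle$. Modules are right modules. An algebraic $2$-complex over $\mathbb{Z}[G]$ is a chain complex $F_2\xrightarrow{\partial_2}F_1\xrightarrow{\partial_1}F_0$ of finitely generated free $\mathbb{Z}[G]$-modules with $\operatorname{coker}\partial_1\cong\mathbb{Z}$ (trivial action) and $\ker\partial_1=\operatorname{im}\partial_2$; its $\pi_2$ is $\ker\partial_2$. Definition of $J$: let $\Sigma=\sum_{i=0}^{2n-1}a^i$. Let $\mathbb{Z}[D_{4n}]^3$ have basis $E_1,E_2,E_3$ and $\mathbb{Z}[D_{4n}]^2$ have basis $e_1,e_2$, and define $\partial_2:\mathbb{Z}[D_{4n}]^3\to\mathbb{Z}[D_{4n}]^2$ by $\partial_2E_1=e_1\Sigma$, $\partial_2E_2=e_2(1+b)$, $\partial_2E_3=e_1(1+ba)+e_2(a-1)$. Then $J=\ker\partial_2$. (This is the second differential of the cellular chain complex of the universal cover of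 the presentation's Cayley complex.) *)

(* Defs.v *)
(* [boolp] is used only to make the image of a linear map a boolean predicate,
   so that cokernels can be formed with [ring_quotient]. *)
From HB Require Import structures.
From mathcomp Require Import all_boot all_order all_algebra.
From mathcomp Require Import all_fingroup all_solvable.
From mathcomp Require Import boolp.

Set Implicit Arguments.
Unset Strict Implicit.
Unset Printing Implicit Defensive.

Import GRing.Theory.
Local Open Scope ring_scope.

(* The integral group ring.  This is a new constant rather than a bare
   {ffun gT -> int}, because the latter carries the pointwise product. *)
Section GroupRing.
Variable gT : finGroupType.

Definition intgr : Type := {ffun gT -> int}.

HB.instance Definition _ := GRing.Zmodule.on intgr.

Definition intgr_of (g : gT) : intgr := [ffun h => (h == g)%:R].

Definition intgr_mul (x y : intgr) : intgr :=
  [ffun g => \sum_(h : gT) x h * y (h^-1 * g)%g].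

Fact intgr_mulA : associative intgr_mul.
Proof.
move=> x y z; apply/ffunP=> g; rewrite !ffunE.
under eq_bigr => h _ do rewrite ffunE mulr_sumr.
under [RHS]eq_bigr => h _ do rewrite ffunE mulr_suml.
rewrite [RHS]exchange_big /=; apply: eq_bigr => h _.
rewrite [RHS](reindex_inj (mulgI h)) /=; apply: eq_bigr => k _.
by rewrite mulKg invMg mulgA mulrA.
Qed.

Fact intgr_mul1 : left_id (intgr_of 1%g) intgr_mul.
Proof.
move=> x; apply/ffunP=> g; rewrite ffunE (bigD1 1%g) //= big1 => [|h /negPf h1].
  by rewrite ffunE eqxx mul1r invg1 mul1g addr0.
by rewrite ffunE h1 mul0r.
Qed.

Fact intgr_mulr1 : right_id (intgr_of 1%g) intgr_mul.
Proof.
move=> x; apply/ffunP=> g; rewrite ffunE (bigD1 g) //= big1 => [|h /negPf hg].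
  by rewrite ffunE mulVg eqxx mulr1 addr0.
by rewrite ffunE -eq_mulVg1 hg mulr0.
Qed.

Fact intgr_mulDl : left_distributive intgr_mul +%R.
Proof.
move=> x y z; apply/ffunP=> g; rewrite !ffunE -big_split /=.
by apply: eq_bigr => h _; rewrite ffunE mulrDl.
Qed.

Fact intgr_mulDr : right_distributive intgr_mul +%R.
Proof.
move=> x y z; apply/ffunP=> g; rewrite !ffunE -big_split /=.
by apply: eq_bigr => h _; rewrite ffunE mulrDr.
Qed.

Fact intgr_oner_neq0 : intgr_of 1%g != 0.
Proof. by apply/eqP => /ffunP/(_ 1%g); rewrite !ffunE eqxx. Qed.

HB.instance Definition _ := GRing.Zmodule_isNzRing.Build intgr
  intgr_mulA intgr_mul1 intgr_mulr1 intgr_mulDl intgr_mulDr intgr_oner_neq0.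

Definition augmentation (x : intgr) : int := \sum_(g : gT) x g.

Fact augmentationM (x y : intgr) :
  augmentation (x * y) = augmentation x * augmentation y.
Proof.
rewrite /augmentation mulr_suml; under eq_bigr => g _ do rewrite ffunE.
rewrite exchange_big /=; apply: eq_bigr => h _; rewrite mulr_sumr.
by rewrite (reindex_inj (mulgI h)) /=; apply: eq_bigr => k _; rewrite mulKg.
Qed.

Fact augmentation1 : augmentation 1 = 1.
Proof.
rewrite /augmentation (bigD1 1%g) //= big1 => [|h /negPf h1]; last first.
  by rewrite ffunE h1.
by rewrite ffunE eqxx addr0.
Qed.

Fact augmentationD (x y : intgr) :
  augmentation (x + y) = augmentation x + augmentation y.
Proof.
by rewrite /augmentation -big_split; apply: eq_bigr => g _; rewrite ffunE.
Qed.

End GroupRing.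

(* A right module over R is a left module over the converse ring:
   r *: v stands for v . r. *)
Notation rmodType R := (lmodType (R : Type)^c).

(* The integers with trivial action: g acts as the identity, hence r acts as
   multiplication by its augmentation. *)
Definition trivZ (gT : finGroupType) : Type := int.

HB.instance Definition _ (gT : finGroupType) := GRing.Zmodule.on (trivZ gT).

Section TrivialModule.
Variable gT : finGroupType.
Local Notation trivZ := (trivZ gT).

Definition trivZ_scale (r : (intgr gT)^c) (z : trivZ) : trivZ :=
  augmentation r * (z : int).

Fact trivZ_scaleA r s z :
  trivZ_scale r (trivZ_scale s z) = trivZ_scale (r * s) z.
Proof.
by rewrite /trivZ_scale (augmentationM (s : intgr gT)) mulrCA mulrA.
Qed.

Fact trivZ_scale1 : left_id 1 trivZ_scale.
Proof. by move=> z; rewrite /trivZ_scale (augmentation1 gT) mul1r. Qed.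

Fact trivZ_scaleDr : right_distributive trivZ_scale +%R.
Proof. by move=> r y z; apply: mulrDr. Qed.

Fact trivZ_scaleDl z : {morph trivZ_scale^~ z : r s / r + s}.
Proof.
by move=> r s; rewrite /trivZ_scale (augmentationD (r : intgr gT)) mulrDl.
Qed.

HB.instance Definition _ := GRing.Zmodule_isLmodule.Build (intgr gT)^c trivZ
  trivZ_scaleA trivZ_scale1 trivZ_scaleDr trivZ_scaleDl.

End TrivialModule.

Section KernelCokernel.
Variables (R : pzRingType) (U V : lmodType R) (f : {linear U -> V}).

Definition ker_pred : {pred U} := fun x => f x == 0.

Fact ker_pred_submod : subsemimod_closed ker_pred.
Proof.
split; last by move=> r x /eqP fx; rewrite unfold_in /ker_pred linearZ_LR fx scaler0.
split; first by rewrite unfold_in /ker_pred linear0.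
by move=> x y /eqP fx /eqP fy; rewrite unfold_in /ker_pred linearD fx fy addr0.
Qed.

HB.instance Definition _ := GRing.isSubmodClosed.Build R U ker_pred
  ker_pred_submod.

Record kernel : Type := Kernel { kernel_val : U; _ : kernel_val \in ker_pred }.

HB.instance Definition _ := [isSub for kernel_val].
HB.instance Definition _ := [Choice of kernel by <:].
HB.instance Definition _ := [SubChoice_isSubLmodule of kernel by <:].

Definition img_pred : {pred V} := fun y => `[< exists x, f x = y >].

Fact img_pred_submod : subsemimod_closed img_pred.
Proof.
split; last first.
  by move=> r _ /asboolP[x <-]; apply/asboolP; exists (r *: x); rewrite linearZ.
split; first by apply/asboolP; exists 0; rewrite linear0.
move=> _ _ /asboolP[x <-] /asboolP[y <-]; apply/asboolP.
by exists (x + y); rewrite linearD.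
Qed.

HB.instance Definition _ := GRing.isSubmodClosed.Build R V img_pred
  img_pred_submod.

Definition cokernel : Type := Quotient.quot img_pred.

HB.instance Definition _ := GRing.Zmodule.on cokernel.

Local Notation proj := (\pi_(Quotient.quot img_pred)%qT).

Definition coker_scale (r : R) (x : cokernel) : cokernel :=
  proj (r *: generic_quotient.repr x).

Fact coker_scale_pi r (v : V) : coker_scale r (proj v) = proj (r *: v).
Proof.
apply/eqP; rewrite -Quotient.idealrBE -scalerBr rpredZ //.
by rewrite Quotient.idealrBE reprK.
Qed.

Fact coker_surj (x : cokernel) : exists v, x = proj v.
Proof. by exists (generic_quotient.repr x); rewrite reprK. Qed.

Fact coker_projD (v w : V) : (proj v : cokernel) + proj w = proj (v + w).
Proof. by rewrite [RHS]raddfD. Qed.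

Fact coker_scaleA r s x :
  coker_scale r (coker_scale s x) = coker_scale (r * s) x.
Proof. by have [v ->] := coker_surj x; rewrite !coker_scale_pi scalerA. Qed.

Fact coker_scale1 : left_id 1 coker_scale.
Proof. by move=> x; have [v ->] := coker_surj x; rewrite coker_scale_pi scale1r. Qed.

Fact coker_scaleDr : right_distributive coker_scale +%R.
Proof.
move=> r x y; have [v ->] := coker_surj x; have [w ->] := coker_surj y.
by rewrite coker_projD !coker_scale_pi scalerDr coker_projD.
Qed.

Fact coker_scaleDl x : {morph coker_scale^~ x : r s / r + s}.
Proof.
move=> r s; have [v ->] := coker_surj x.
by rewrite !coker_scale_pi scalerDl coker_projD.
Qed.

HB.instance Definition _ := GRing.Zmodule_isLmodule.Build R cokernel
  coker_scaleA coker_scale1 coker_scaleDr coker_scaleDl.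

End KernelCokernel.

Definition lmod_iso (R : pzRingType) (U V : lmodType R) : Prop :=
  exists f : {linear U -> V}, bijective f.

Definition fg_free (R : nzRingType) (U : lmodType R) : Prop :=
  exists r : nat, lmod_iso U 'rV[R]_r.

Section AlgebraicTwoComplexes.
Variable gT : finGroupType.

Record alg2complex := Alg2Complex {
  a2c_F2 : rmodType (intgr gT);
  a2c_F1 : rmodType (intgr gT);
  a2c_F0 : rmodType (intgr gT);
  a2c_d2 : {linear a2c_F2 -> a2c_F1};
  a2c_d1 : {linear a2c_F1 -> a2c_F0};
  a2c_free2 : fg_free a2c_F2;
  a2c_free1 : fg_free a2c_F1;
  a2c_free0 : fg_free a2c_F0;
  a2c_complex : forall x, a2c_d1 (a2c_d2 x) = 0;
  a2c_coker : lmod_iso (cokernel a2c_d1) (trivZ gT);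
  a2c_exact : forall y, a2c_d1 y = 0 <-> exists x, a2c_d2 x = y
}.

Definition pi2 (X : alg2complex) : rmodType (intgr gT) := kernel (a2c_d2 X).

Record chain_map (X Y : alg2complex) := ChainMap {
  cm2 : {linear a2c_F2 X -> a2c_F2 Y};
  cm1 : {linear a2c_F1 X -> a2c_F1 Y};
  cm0 : {linear a2c_F0 X -> a2c_F0 Y};
  cm_d2 : forall x, cm1 (a2c_d2 X x) = a2c_d2 Y (cm2 x);
  cm_d1 : forall x, cm0 (a2c_d1 X x) = a2c_d1 Y (cm1 x)
}.

(* [chain_homotopic_id f g] : the composite g o f is homotopic to the
   identity of X. *)
Definition chain_homotopic_id (X Y : alg2complex)
    (f : chain_map X Y) (g : chain_map Y X) : Prop :=
  exists (s0 : {linear a2c_F0 X -> a2c_F1 X})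
         (s1 : {linear a2c_F1 X -> a2c_F2 X}),
  [/\ forall x, cm0 g (cm0 f x) - x = a2c_d1 X (s0 x),
      forall x, cm1 g (cm1 f x) - x = a2c_d2 X (s1 x) + s0 (a2c_d1 X x)
    & forall x, cm2 g (cm2 f x) - x = s1 (a2c_d2 X x)].

Definition chain_homotopy_equivalent (X Y : alg2complex) : Prop :=
  exists (f : chain_map X Y) (g : chain_map Y X),
    chain_homotopic_id f g /\ chain_homotopic_id g f.

End AlgebraicTwoComplexes.

Section Dihedral.
Variables (gT : finGroupType) (n : nat) (a b : gT).

(* gT is the group presented by <a, b | a^2n = b^2 = e, aba = b>.  The first
   clause fixes the isomorphism type only; the others say that a and b are
   themselves generators satisfying the relations. *)
Definition dihedral_presentation : Prop :=
  [/\ ([set: gT] \isog Grp (x : y : x ^+ (2 * n), y ^+ 2, x * y * x = y))%g,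
      (<<[set a; b]>> = [set: gT])%g,
      (a ^+ (2 * n) = 1)%g, (b ^+ 2 = 1)%g & (a * b * a = b)%g].

Local Notation ZG := (intgr gT).
Local Notation el := (@intgr_of gT).

Definition sigma_a : ZG := \sum_(i < 2 * n) el (a ^+ i)%g.

(* The free right module on r generators is 'rV[ZG^c]_r; v *m M sends the i-th
   basis vector to the i-th row of M, and is linear for the right action since
   the product of 'rV[ZG^c]_r and 'M[ZG^c]_(r, s) is that of the converse ring:
   (v *m M) 0 j is the sum of the M i j * v 0 i computed in ZG.  The entries
   themselves are computed in ZG. *)
Definition J_bd (i : 'I_3) (j : 'I_2) : ZG :=
  nth 0 (nth [::]
    [:: [:: sigma_a;             0        ];
        [:: 0;                   1 + el b ];
        [:: 1 + el (b * a)%g;   el a - 1 ]] i) j.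

Definition J_mx : 'M[ZG^c]_(3, 2) := \matrix_(i, j) J_bd i j.

Definition J_d2 : {linear 'rV[ZG^c]_3 -> 'rV[ZG^c]_2} := mulmxr J_mx.

Definition J : rmodType ZG := kernel J_d2.

End Dihedral.

(* Main.v *)
From HB Require Import structures.
Require Import Defs.
From mathcomp Require Import all_boot all_order all_algebra.
From mathcomp Require Import all_fingroup all_solvable.
From mathcomp Require Import boolp ring.

(** The homotopy type of an algebraic 2-complex with a given second homotopy
    module [M] is measured by a degree.  A homomorphism between second homotopy
    modules always extends to a chain map, because free modules over [Z[G]] are
    injective relative to lattices ([linearize], [chain_map_extending]); the
    chain map multiplies the zeroth homology [Z] by an integer.  A chain map
    vanishing on the second homotopy module is homotopic to one concentrated in
    degree zero that factors through the norm element ([zero_on_pi2]).  So the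
    homomorphism determines the degree modulo [|G|], every residue of that class
    is attained ([degree_shift]), an isomorphism has a degree prime to [|G|]
    ([degree_unit]), and an isomorphism that extends with degree one is a
    homotopy equivalence ([equivalence_of_degree1]).  Two complexes with the
    same [M] are thus equivalent as soon as every unit modulo [|G|] is the degree
    of an automorphism of [M] ([equivalent_of_degrees]).

    For [M] the sum of [J] and a free module, degrees are computed on the Cayley
    complex of the presentation with a free summand added in degree two; it is
    exact by a computation with the relations ([cayley_exact]).  Let
    [t = b * a], let [r = 2 * j + 1] be prime to [4 * n], and put
    [c = a + ... + a ^ j].  Left multiplication by [1 + c * (1 + b)] in degree
    zero has augmentation [r].  From
    [(1 + b) * (a - 1) = (a - 1) * (1 - t)] and [(1 + b) * (b - 1) = 0] it lifts
    to degree one as [p = 1 + c * (1 - t)] on the first generator and the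
    identity on the second; since [p * (1 + t) = 1 + t], it lifts to degree two
    as [p] on the first generator and the identity on all others.  Now [A = p - 1]
    satisfies [A * A = (u - 1) * A] where [u], a symmetric translate of
    [1 + a + ... + a ^ (r - 1)], is central, so that [p * (u - A) = u].
    As [u] is a unit modulo the sum [sigma] of the powers of [a], so is [p]; and
    on [J] invertibility modulo [sigma] is enough, because [sigma] annihilates
    the image of [A] there ([dihedral_units], [cayley_degree]). *)

Set Implicit Arguments.
Unset Strict Implicit.
Unset Printing Implicit Defensive.

Import Order.TTheory GRing.Theory.
Local Open Scope ring_scope.

(** * Linear maps, isomorphisms and cokernels *)

Section Linear.
Variable R : nzRingType.
Implicit Types U V W : lmodType R.

Lemma additive_of (A B : zmodType) (f : A -> B) :
  {morph f : x y / x + y} -> exists F : {additive A -> B}, F =1 f.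
Proof.
move=> fD.
have f0 : f 0 = 0 by apply: (addrI (f 0)); rewrite -fD !addr0.
have fB : zmod_morphism f.
  move=> x y; rewrite fD; congr (_ + _).
  by apply: (addrI (f y)); rewrite -fD !subrr.
pose L := GRing.isZmodMorphism.Build A B f fB.
pose F : {additive A -> B} := HB.pack f L.
by exists F.
Qed.

Lemma linear_of U V (f : U -> V) :
  linear f -> exists F : {linear U -> V}, F =1 f.
Proof.
move=> fL; pose L := GRing.isLinear.Build R U V *:%R f fL.
pose F : {linear U -> V} := HB.pack f L.
by exists F.
Qed.

Lemma lmod_isoP U V :
  lmod_iso U V ->
  exists (f : {linear U -> V}) (g : {linear V -> U}), cancel f g /\ cancel g f.
Proof.
case=> f [g fg gf].
have [G Gg] := linear_of (GRing.can2_linear fg gf).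
by exists f, G; split=> x; rewrite Gg.
Qed.

Lemma lmod_iso_of_can U V (f : {linear U -> V}) (g : V -> U) :
  cancel f g -> cancel g f -> lmod_iso U V.
Proof. by move=> fg gf; exists f; exists g. Qed.

Lemma lmod_iso_sym U V : lmod_iso U V -> lmod_iso V U.
Proof.
by case/lmod_isoP => f [g [fK gK]]; apply: (lmod_iso_of_can (f := g) gK fK).
Qed.

Lemma lmod_iso_trans U V W : lmod_iso U V -> lmod_iso V W -> lmod_iso U W.
Proof.
move=> [f fb] [g gb]; exists (g \o f); exact: bij_comp.
Qed.

Lemma lmod_iso_of_bij U V (f : {linear U -> V}) :
  (forall x, f x = 0 -> x = 0) -> (forall y, exists x, f x = y) ->
  lmod_iso U V.
Proof.
move=> inj surj; pose g y := sval (cid (surj y)).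
have gf : cancel g f by move=> y; rewrite /g; case: cid.
apply: (lmod_iso_of_can _ gf) => x.
by apply/eqP; rewrite -subr_eq0; apply/eqP/inj; rewrite linearB /= gf subrr.
Qed.

Section Cokernel.
Variables (U V : lmodType R) (f : {linear U -> V}).

Definition coker_proj (v : V) : cokernel f :=
  (\pi_(Quotient.quot (img_pred f)) v)%qT.

Lemma coker_proj_linear : linear coker_proj.
Proof.
move=> r x y; rewrite /coker_proj -coker_projD; congr (_ + _).
by rewrite -coker_scale_pi.
Qed.

Lemma coker_proj_eq0 v : coker_proj v = 0 <-> exists x, f x = v.
Proof.
have -> : (0 : cokernel f) = coker_proj 0.
  by symmetry; have [F e] := linear_of coker_proj_linear; rewrite -e linear0.
split=> [/eqP|[x fx]].
  by rewrite -Quotient.idealrBE subr0 => /asboolP.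
by apply/eqP; rewrite -Quotient.idealrBE subr0; apply/asboolP; exists x.
Qed.

Lemma coker_isoP W :
  lmod_iso (cokernel f) W <->
  exists e : {linear V -> W},
    (forall w, exists v, e v = w) /\ (forall v, e v = 0 <-> exists x, f x = v).
Proof.
have [p pE] := linear_of coker_proj_linear.
have p_surj (z : cokernel f) : exists v, p v = z.
  by have [v ->] := coker_surj z; exists v; rewrite pE.
split=> [/lmod_isoP[h [h' [hK h'K]]]|[e [e_surj e_ker]]].
  exists (h \o p); split=> [w|v] /=.
    by have [v pv] := p_surj (h' w); exists v; rewrite pv h'K.
  rewrite -coker_proj_eq0 -pE; split=> [e|->]; last by rewrite linear0.
  by rewrite -(hK (p v)) e linear0.
pose q (z : cokernel f) := e (sval (cid (p_surj z))).
have qp v : q (p v) = e v.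
  rewrite /q; case: cid => w /= pw; apply/eqP.
  rewrite -subr_eq0 -linearB; apply/eqP/e_ker/coker_proj_eq0.
  by rewrite -pE linearB /= pw subrr.
have q_lin : linear q.
  move=> r x y; have [v <-] := p_surj x; have [w <-] := p_surj y.
  by rewrite -linearP !qp linearP.
have [Q QE] := linear_of q_lin.
apply: (@lmod_iso_of_bij _ _ Q) => [z|w].
  have [v <-] := p_surj z; rewrite QE qp => /e_ker/coker_proj_eq0.
  by rewrite pE.
by have [v <-] := e_surj w; exists (p v); rewrite QE qp.
Qed.

End Cokernel.

Lemma kernelP U V (f : {linear U -> V}) (x : kernel f) : f (\val x) = 0.
Proof. by case: x => x /= /eqP. Qed.

Lemma kernel_lift U V (f : {linear U -> V}) x :
  f x = 0 -> exists z : kernel f, \val z = x.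
Proof.
move=> fx; have xP : x \in ker_pred f by apply/eqP.
by exists (Kernel xP).
Qed.

Lemma kernel_corestrict U V W (f : {linear U -> V}) (h : {linear W -> U}) :
  (forall w, f (h w) = 0) ->
  exists H : {linear W -> kernel f}, forall w, \val (H w) = h w.
Proof.
move=> fh; pose k w := sval (cid (kernel_lift (fh w))).
have kE w : \val (k w) = h w by rewrite /k; case: cid.
have k_lin : linear k.
  by move=> r x y; apply: val_inj; rewrite linearP /= !kE linearP.
by have [H HE] := linear_of k_lin; exists H => w; rewrite HE kE.
Qed.

Lemma kernel_restrict U V (f : {linear U -> V}) (h : {linear U -> U}) :
  (forall u, f u = 0 -> f (h u) = 0) ->
  exists H : {linear kernel f -> kernel f}, forall z, \val (H z) = h (\val z).
Proof.
move=> fh; apply: (@kernel_corestrict _ _ _ f (h \o \val)) => z /=.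
exact/fh/kernelP.
Qed.

Lemma linear_on_fst U W (h : {linear U -> U}) :
  exists H : {linear (U * W)%type -> (U * W)%type}, H =1 fun v => (h v.1, v.2).
Proof. by apply: linear_of => r x y; rewrite /= linearP. Qed.

Lemma kernel_fst_iso U V W (f : {linear U -> V}) :
  lmod_iso (kernel (f \o (fst : {linear (U * W)%type -> U})))
           (kernel f * W)%type.
Proof.
set F := f \o _.
have [h hE] := @kernel_corestrict _ _ _ f
  ((fst : {linear (U * W)%type -> U}) \o (\val : {linear kernel F -> _}))
  (@kernelP _ _ F).
have [g gE] : exists g : {linear kernel F -> (kernel f * W)%type},
    g =1 fun z => (h z, (\val z).2).
  by apply: linear_of => r x y; rewrite !linearP.
apply: (@lmod_iso_of_bij _ _ g) => [z|[u w]].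
  rewrite gE => -[h0 z2]; apply: val_inj; have := hE z; rewrite h0 /= => z1.
  by rewrite [LHS]surjective_pairing -z1 z2.
have [z zE] : exists z : kernel F, \val z = (\val u, w).
  exact/kernel_lift/(kernelP u).
exists z; rewrite gE zE; congr (_, _).
by apply: val_inj; rewrite hE /= zE.
Qed.

End Linear.

(** * Free modules over an integral group ring *)

Section GroupRingModules.
Variable gT : finGroupType.
Local Notation ZG := (intgr gT).
Local Notation R := (ZG)^c.
Local Notation el := (@intgr_of gT).
Local Notation act g x := ((el g : R) *: x).

Lemma elM g h : el g * el h = el (g * h)%g.
Proof.
apply/ffunP=> k; rewrite !ffunE (bigD1 g) //= big1 => [|i /negPf ig].
  by rewrite !ffunE eqxx mul1r addr0 -(inj_eq (mulgI g)) mulKVg.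
by rewrite ffunE ig mul0r.
Qed.

Lemma elX g i : el (g ^+ i)%g = el g ^+ i.
Proof. by elim: i => // i IH; rewrite expgS exprS -IH elM. Qed.

Lemma augmentation_el g : augmentation (el g) = 1.
Proof.
rewrite /augmentation (bigD1 g) //= big1 => [|h /negPf hg].
  by rewrite ffunE eqxx addr0.
by rewrite ffunE hg.
Qed.

Lemma augmentationB (x y : ZG) :
  augmentation (x - y) = augmentation x - augmentation y.
Proof.
by rewrite /augmentation -sumrB; apply: eq_bigr => g _; rewrite !ffunE.
Qed.

Lemma intgr_coef_sum (I : Type) (r : seq I) (F : I -> ZG) g :
  (\sum_(i <- r) F i) g = \sum_(i <- r) F i g.
Proof.
by elim: r => [|i r IH]; rewrite ?big_nil ?big_cons ffunE // IH.
Qed.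

Lemma intgr_coefMz (x : ZG) (z : int) g : (x *~ z) g = x g *~ z.
Proof.
have N n : (x *+ n) g = x g *+ n.
  by elim: n => [|n IH]; rewrite ?mulr0n ?mulrS !ffunE ?IH.
case: z => n; first exact: N.
by rewrite !NegzE !mulrNz ffunE; congr (- _); apply: N.
Qed.

Lemma intgr_expand (x : ZG) : x = \sum_g el g *~ x g.
Proof.
apply/ffunP=> h; rewrite intgr_coef_sum (bigD1 h) //= big1 => [|g /negPf gh].
  by rewrite intgr_coefMz ffunE eqxx addr0 -mulrzr mul1r intz.
by rewrite intgr_coefMz ffunE eq_sym gh mul0rz.
Qed.

Lemma actM (V : lmodType R) g h (v : V) : act g (act h v) = act (h * g)%g v.
Proof. by rewrite scalerA -elM. Qed.

Lemma scale_expand (V : lmodType R) (s : R) (v : V) :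
  s *: v = \sum_g act g v *~ (s : ZG) g.
Proof.
rewrite {1}(intgr_expand s) scaler_suml; apply: eq_bigr => g _.
have S : {morph (fun r : R => r *: v) : x y / x + y}.
  by move=> x y; rewrite scalerDl.
by have [F FE] := additive_of S; rewrite -!FE raddfMz.
Qed.

Lemma equivariant_linear (V W : lmodType R) (f : V -> W) :
  {morph f : x y / x + y} -> (forall g x, f (act g x) = act g (f x)) ->
  exists F : {linear V -> W}, F =1 f.
Proof.
move=> fD fG; apply: linear_of => r x y; rewrite fD; congr (_ + _).
have [F FE] := additive_of fD; rewrite -!FE !scale_expand raddf_sum.
by apply: eq_bigr => g _; rewrite raddfMz FE fG FE.
Qed.

(** A finitely generated free module is coinduced: a linear map into it is
    determined by the coefficients at the identity of its coordinates, and
    these can be any additive functions.  So an additive map [h] can be averaged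
    to a linear one without changing it at the vectors where it already commutes
    with the group.  This is the source of the injectivity of free modules
    relative to lattices. *)
Lemma linearize (V F : lmodType R) (h : {additive V -> F}) : fg_free F ->
  exists H : {linear V -> F},
    forall x, (forall g, h (act g x) = act g (h x)) -> H x = h x.
Proof.
case=> r /lmod_isoP[p [q [pK qK]]].
pose k (x : V) : 'rV[R]_r :=
  \row_i ([ffun g => (p (h (act g^-1%g x)) 0 i : ZG) 1%g] : ZG).
have kD : {morph k : x y / x + y}.
  move=> x y; apply/rowP=> i; rewrite !mxE; apply/ffunP=> g.
  by rewrite !ffunE scalerDr !raddfD /= mxE ffunE.
have kG g x : k (act g x) = act g (k x).
  apply/rowP=> i; rewrite !mxE; apply/ffunP=> x0.
  have -> (s t : R) : s * t = (t : ZG) * (s : ZG) by [].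
  rewrite !ffunE actM (bigD1 (x0 * g^-1)%g) //= big1 => [|y yx].
    by rewrite !ffunE invMg invgK mulgKV eqxx mulr1 addr0.
  rewrite !ffunE (_ : (_ == _) = false) ?mulr0 //.
  apply: contra_neqF yx => /eqP e.
  by rewrite -e invMg invgK mulKVg.
have [K KE] := equivariant_linear kD kG.
exists (q \o K) => x hx /=; rewrite KE; apply: (can_inj pK); rewrite qK.
apply/rowP=> i; rewrite mxE; apply/ffunP=> g; rewrite ffunE hx linearZ mxE.
have -> (s t : R) : s * t = (t : ZG) * (s : ZG) by [].
rewrite ffunE (bigD1 g) //= big1 => [|y yx].
  by rewrite !ffunE mulg1 eqxx mulr1 addr0.
rewrite !ffunE mulg1 (_ : (_ == _) = false) ?mulr0 //.
by apply: contra_neqF yx => /eqP/invg_inj.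
Qed.

(** The additive splitting [s] gives the additive extension [g \o s], which
    commutes with the group on the image of [u] and can hence be averaged. *)
Lemma extend_along (V W F : lmodType R) (u : {linear V -> W})
    (s : {additive W -> V}) (g : {linear V -> F}) :
  fg_free F -> (forall x, u (s (u x)) = u x) ->
  (forall x, u x = 0 -> g x = 0) ->
  exists h : {linear W -> F}, forall x, h (u x) = g x.
Proof.
move=> freeF us gu; have [h hE] := linearize (g \o s) freeF.
have gsu x : g (s (u x)) = g x.
  by apply/eqP; rewrite -subr_eq0 -linearB gu // linearB /= us subrr.
exists h => x; rewrite hE /= => [|k]; first exact: gsu.
by rewrite -linearZ /= !gsu linearZ.
Qed.

Lemma rowZ_expand r (x : 'rV[R]_r) :
  x = \sum_i \sum_g act g (delta_mx 0 i) *~ (x 0 i : ZG) g.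
Proof.
rewrite {1}(row_sum_delta x); apply: eq_bigr => i _.
exact: scale_expand.
Qed.

(** A free module over the group ring is free over the integers, so additive
    maps out of it lift through surjections. *)
Lemma free_additive_lift (F : lmodType R) (A B : zmodType)
    (p : {additive A -> B}) (f : {additive F -> B}) :
  fg_free F -> (forall x, exists a, p a = f x) ->
  exists s : {additive F -> A}, forall x, p (s x) = f x.
Proof.
case=> r /lmod_isoP[e [e' [eK e'K]]] pf.
pose bas i g : F := e' (act g (delta_mx 0 i)).
pose c i g := sval (cid (pf (bas i g))).
have cE i g : p (c i g) = f (bas i g) by rewrite /c; case: cid.
pose s x := \sum_i \sum_g c i g *~ (e x 0 i : ZG) g.
have sD : {morph s : x y / x + y}.
  move=> x y; rewrite /s -big_split; apply: eq_bigr => i _ /=.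
  rewrite -big_split; apply: eq_bigr => g _ /=.
  by rewrite linearD mxE ffunE mulrzDr.
have [S SE] := additive_of sD; exists S => x.
rewrite SE /s -[x in RHS]eK [e x in RHS]rowZ_expand !raddf_sum.
apply: eq_bigr => i _; rewrite !raddf_sum; apply: eq_bigr => g _.
by rewrite !raddfMz cE.
Qed.

Definition group_norm : ZG := \sum_g el g.

Lemma augmentation_norm : augmentation group_norm = #|gT|%:Z.
Proof.
rewrite /augmentation -sum1_card -natz natr_sum; apply: eq_bigr => g _.
rewrite intgr_coef_sum (bigD1 g) //= big1 => [|h /negPf hg].
  by rewrite ffunE eqxx addr0.
by rewrite ffunE eq_sym hg.
Qed.

Lemma el_normr g : group_norm * el g = group_norm.
Proof.
rewrite mulr_suml [RHS](reindex_inj (mulIg g)) /=.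
by apply: eq_bigr => h _; rewrite elM.
Qed.

(** The vanishing of Tate cohomology in degree zero: the coefficients of an
    invariant vector are constant along the group. *)
Lemma free_invariant (F : lmodType R) (z : F) :
  fg_free F -> (forall g, act g z = z) ->
  exists w, z = (group_norm : R) *: w.
Proof.
case=> r /lmod_isoP[p [q [pK qK]]] zG.
pose w : 'rV[R]_r := \row_i (1 *~ (p z 0 i : ZG) 1%g).
exists (q w); apply: (can_inj pK); rewrite linearZ /= qK.
apply/rowP=> i; rewrite !mxE mulrzr.
apply/ffunP=> g; rewrite intgr_coefMz intgr_coef_sum (bigD1 g) //=.
rewrite big1 => [|h /negPf hg]; last by rewrite ffunE eq_sym hg.
rewrite ffunE eqxx addr0 -mulrzr mul1r intz.
have := congr1 (fun v => (p v 0 i : ZG) g) (zG g).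
rewrite linearZ mxE => <-.
have -> (s t : R) : s * t = (t : ZG) * (s : ZG) by [].
rewrite ffunE (bigD1 1%g) //= big1 => [|h h1].
  by rewrite ffunE invg1 mul1g eqxx mulr1 addr0.
rewrite ffunE (_ : (_ == _) = false) ?mulr0 //; apply: contra_neqF h1 => /eqP e.
by apply: invg_inj; apply: (mulIg g); rewrite e invg1 mul1g.
Qed.

End GroupRingModules.

(** * Chain maps of algebraic 2-complexes and their degrees *)

Section Complexes.
Variable gT : finGroupType.
Local Notation ZG := (intgr gT).
Local Notation R := (ZG)^c.
Local Notation el := (@intgr_of gT).
Local Notation act g x := ((el g : R) *: x).
Local Notation Z := (trivZ gT).
Implicit Types X Y : alg2complex gT.

Definition augments X (e : {linear a2c_F0 X -> Z}) : Prop :=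
  (exists y, e y = 1 :> int) /\
  (forall v, e v = 0 <-> exists x, a2c_d1 X x = v).

Lemma augments_exists X : exists e, @augments X e.
Proof.
have /coker_isoP[e [e_surj e_ker]] := a2c_coker X.
by exists e; split=> //; apply: (e_surj (1 : int)).
Qed.

Lemma trivZ_act (g : gT) (z : Z) : act g z = z.
Proof.
have -> : act g z = augmentation (el g) * (z : int) by [].
by rewrite augmentation_el mul1r.
Qed.

Lemma trivZ_linear_act (V : lmodType R) (e : {linear V -> Z}) (g : gT) v :
  e (act g v) = e v.
Proof. by rewrite linearZ /= trivZ_act. Qed.

Lemma trivZ_mulz (z : Z) (s : int) : z *~ s = (z : int) * s :> int.
Proof. exact: (mulrzz (z : int) s). Qed.

Section Augmented.
Variables (X : alg2complex gT) (e : {linear a2c_F0 X -> Z}).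
Hypothesis eX : augments e.

Lemma aug_d1 x : e (a2c_d1 X x) = 0.
Proof. by apply/(eX.2 _); exists x. Qed.

(** Over the integers the augmented complex is exact and free, hence
    contractible. *)
Lemma additive_contraction :
  exists (y : a2c_F0 X) (s0 : {additive a2c_F0 X -> a2c_F1 X})
         (s1 : {additive a2c_F1 X -> a2c_F2 X}),
  [/\ e y = 1 :> int, forall v, a2c_d1 X (s0 v) = v - y *~ (e v : int)
    & forall v, a2c_d2 X (s1 v) = v - s0 (a2c_d1 X v)].
Proof.
have [[y ey] e_ker] := eX.
have [q qE] : exists q : {additive a2c_F0 X -> a2c_F0 X},
    q =1 fun v => v - y *~ (e v : int).
  apply: additive_of => v w.
  by rewrite linearD mulrzDr opprD addrACA.
have [v|s0 s0E] := free_additive_lift (p := a2c_d1 X) (f := q) (a2c_free0 X).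
  apply/(e_ker _); rewrite qE linearB raddfMz.
  by apply/eqP; rewrite subr_eq0 /= trivZ_mulz ey mul1r.
have [t tE] : exists t : {additive a2c_F1 X -> a2c_F1 X},
    t =1 fun v => v - s0 (a2c_d1 X v).
  apply: additive_of => v w.
  by rewrite [a2c_d1 X _]linearD [s0 _]raddfD opprD addrACA.
have [v|s1 s1E] := free_additive_lift (p := a2c_d2 X) (f := t) (a2c_free1 X).
  apply/(a2c_exact _); rewrite tE linearB s0E qE aug_d1 mulr0z subr0.
  exact: subrr.
exists y, s0, s1; split=> // v; first by rewrite s0E qE.
by rewrite s1E tE.
Qed.

Lemma extend_d2 (F : lmodType R) (g : {linear a2c_F2 X -> F}) :
  fg_free F -> (forall x, a2c_d2 X x = 0 -> g x = 0) ->
  exists h : {linear a2c_F1 X -> F}, forall x, h (a2c_d2 X x) = g x.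
Proof.
move=> freeF; have [y [s0 [s1 [_ _ s1E]]]] := additive_contraction.
apply: (extend_along (s := s1)) freeF _ => x.
by rewrite s1E a2c_complex raddf0 subr0.
Qed.

Lemma extend_d1 (F : lmodType R) (g : {linear a2c_F1 X -> F}) :
  fg_free F -> (forall x, g (a2c_d2 X x) = 0) ->
  exists h : {linear a2c_F0 X -> F}, forall x, h (a2c_d1 X x) = g x.
Proof.
move=> freeF gd; have [y [s0 [s1 [_ s0E _]]]] := additive_contraction.
apply: (extend_along (s := s0)) freeF _ _ => x.
  by rewrite s0E aug_d1 mulr0z subr0.
by move/(a2c_exact _) => [z <-].
Qed.

Lemma extend_pi2 (F : lmodType R) (g : {linear pi2 X -> F}) :
  fg_free F ->
  exists h : {linear a2c_F2 X -> F}, forall x : pi2 X, h (\val x) = g x.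
Proof.
move=> freeF; have [y [s0 [s1 [_ _ s1E]]]] := additive_contraction.
have ker x : a2c_d2 X (x - s1 (a2c_d2 X x)) = 0.
  by rewrite linearB s1E a2c_complex raddf0 subr0 subrr.
pose r x : pi2 X := sval (cid (kernel_lift (ker x))).
have rE x : \val (r x) = x - s1 (a2c_d2 X x) by rewrite /r; case: cid.
have rK (x : pi2 X) : r (\val x) = x.
  by apply: val_inj; rewrite rE kernelP raddf0 subr0.
have grD : {morph (fun x => g (r x)) : x y / x + y}.
  move=> x y1; rewrite -linearD; congr (g _); apply: val_inj.
  by rewrite linearD /= !rE [a2c_d2 X _]linearD [s1 _]raddfD opprD addrACA.
have [gr grE] := additive_of grD; have [h hE] := linearize gr freeF.
exists h => x; rewrite hE => [|k]; first by rewrite grE rK.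
have -> : act k (\val x) = \val (act k x) by rewrite linearZ.
by rewrite !grE !rK linearZ.
Qed.

End Augmented.

Definition induces X Y (f : chain_map X Y) (t : pi2 X -> pi2 Y) : Prop :=
  forall x, cm2 f (\val x) = \val (t x).

Definition has_degree X Y (e : {linear a2c_F0 X -> Z})
    (e' : {linear a2c_F0 Y -> Z}) (f : chain_map X Y) (s : int) : Prop :=
  forall x, e' (cm0 f x) = (e x : int) * s :> int.

(** Chain maps are extended from the top degree down rather than lifted from the
    bottom up: additive contractibility makes the dual complex exact too. *)
Lemma chain_map_extending X Y (t : {linear pi2 X -> pi2 Y}) :
  exists f : chain_map X Y, induces f t.
Proof.
have [e eX] := augments_exists X.
have [f2 f2E] :=
  extend_pi2 eX ((\val : {linear pi2 Y -> a2c_F2 Y}) \o t) (a2c_free2 Y).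
have [|f1 f1E] := extend_d2 eX (g := a2c_d2 Y \o f2) (a2c_free1 Y).
  by move=> x /kernel_lift[z <-] /=; rewrite f2E kernelP.
have [|f0 f0E] := extend_d1 eX (g := a2c_d1 Y \o f1) (a2c_free0 Y).
  by move=> x; rewrite /= f1E a2c_complex.
by exists (ChainMap f1E f0E).
Qed.

Lemma degree_exists X Y (e : {linear a2c_F0 X -> Z})
    (e' : {linear a2c_F0 Y -> Z}) (f : chain_map X Y) :
  augments e -> augments e' -> exists s, has_degree e e' f s.
Proof.
move=> eX eY; have [y [s0 [_ [ey s0E _]]]] := additive_contraction eX.
exists (e' (cm0 f y)) => x.
have /(congr1 (fun v => e' (cm0 f v))) := s0E x.
rewrite cm_d1 (aug_d1 eY) !linearB => /esym/eqP.
rewrite subr_eq0 => /eqP ->; rewrite !raddfMz.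
by rewrite trivZ_mulz mulrC.
Qed.

Definition cm_comp X Y W (g : chain_map Y W) (f : chain_map X Y) :
  chain_map X W.
Proof.
exists (cm2 g \o cm2 f) (cm1 g \o cm1 f) (cm0 g \o cm0 f) => x /=.
  by rewrite !cm_d2.
by rewrite !cm_d1.
Defined.

Definition cm_sub_id X (f : chain_map X X) : chain_map X X.
Proof.
exists (cm2 f \- idfun) (cm1 f \- idfun) (cm0 f \- idfun) => x /=.
  by rewrite cm_d2 linearB.
by rewrite cm_d1 linearB.
Defined.

Lemma has_degree_comp X Y W e1 e2 e3 (g : chain_map Y W) (f : chain_map X Y)
    s s' :
  has_degree e1 e2 f s -> has_degree e2 e3 g s' ->
  has_degree e1 e3 (cm_comp g f) (s * s').
Proof. by move=> fs gs x; rewrite /= gs fs mulrA. Qed.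

Lemma has_degree_sub_id X e (f : chain_map X X) s :
  has_degree e e f s -> has_degree e e (cm_sub_id f) (s - 1).
Proof. by move=> fs x; rewrite /= linearB /= mulrBr mulr1 -fs. Qed.

Lemma induces_comp X Y W (g : chain_map Y W) (f : chain_map X Y) t t' :
  induces f t -> induces g t' -> induces (cm_comp g f) (t' \o t).
Proof. by move=> ft gt x; rewrite /= ft gt. Qed.

(** Sending [x] to a multiple of [e x] times the norm of a vector of augmentation
    one is a chain map concentrated in degree zero; the augmentation of the norm
    element is the order of the group. *)
Lemma degree_shift X Y e e' (f : chain_map X Y) t s (q : int) :
  augments e -> augments e' -> induces f t -> has_degree e e' f s ->
  exists f' : chain_map X Y,
    induces f' t /\ has_degree e e' f' (s + q * #|gT|%:Z).
Proof.
move=> eX eY ft fs; have [y ey] := eY.1.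
pose N : R := group_norm gT.
have [h hE] : exists h : {linear a2c_F0 X -> a2c_F0 Y},
    h =1 fun x => (N *: y) *~ ((e x : int) * q).
  apply: equivariant_linear => [x x'|g x].
    by rewrite linearD /= (mulrDl (e x : int)) mulrzDr.
  rewrite trivZ_linear_act scalerMzr scalerA.
  by congr (_ *: _); rewrite -[LHS](el_normr g).
have hd x : (cm0 f \+ h) (a2c_d1 X x) = a2c_d1 Y (cm1 f x).
  by rewrite /= hE (aug_d1 eX) mul0r mulr0z addr0 cm_d1.
exists (ChainMap (cm_d2 f) hd); split=> // x.
rewrite /= linearD /= fs hE raddfMz /= linearZ /=.
rewrite trivZ_mulz.
have -> : N *: e' y = augmentation (N : ZG) * (e' y : int) by [].
by rewrite augmentation_norm ey mulr1 mulrDr [_%:Z * _]mulrC mulrA.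
Qed.

(** A chain map vanishing on the second homotopy modules is, up to homotopy,
    the augmentation followed by the inclusion of an invariant vector; all
    such vectors are norms, whence the divisibility of the degree. *)
Lemma zero_on_pi2 X Y e e' (f : chain_map X Y) :
  augments e -> augments e' ->
  (forall x, a2c_d2 X x = 0 -> cm2 f x = 0) ->
  exists (s0 : {linear a2c_F0 X -> a2c_F1 Y})
         (s1 : {linear a2c_F1 X -> a2c_F2 Y}) (w : a2c_F0 Y),
  [/\ forall x, cm2 f x = s1 (a2c_d2 X x),
      forall x, cm1 f x = a2c_d2 Y (s1 x) + s0 (a2c_d1 X x),
      forall x, cm0 f x = a2c_d1 Y (s0 x)
                          + ((group_norm gT : R) *: w) *~ (e x : int)
    & has_degree e e' f (#|gT|%:Z * e' w)].
Proof.
move=> eX eY f20; have [s1 s1E] := extend_d2 eX (a2c_free2 Y) f20.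
have [|s0 s0E] := extend_d1 eX (g := cm1 f \- (a2c_d2 Y \o s1)) (a2c_free1 Y).
  by move=> x; rewrite /= cm_d2 s1E subrr.
pose h : {linear a2c_F0 X -> a2c_F0 Y} := cm0 f \- (a2c_d1 Y \o s0).
have hd x : h (a2c_d1 X x) = 0.
  by rewrite /h /= cm_d1 s0E /= linearB a2c_complex subr0 subrr.
have [y [t0 [_ [ey t0E _]]]] := additive_contraction eX.
have hy x : h x = h y *~ (e x : int).
  apply/eqP; rewrite -subr_eq0 -raddfMz -linearB -t0E.
  exact/eqP/hd.
have [|w wE] := free_invariant (z := h y) (a2c_free0 Y).
  by move=> g; have := hy (act g y); rewrite trivZ_linear_act ey linearZ.
have f0E x : cm0 f x = a2c_d1 Y (s0 x)
                          + ((group_norm gT : R) *: w) *~ (e x : int).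
  by rewrite -wE -hy /h /= addrC subrK.
exists s0, s1, w; split=> // x; first by rewrite s0E /= addrC subrK.
rewrite f0E linearD /= (aug_d1 eY) add0r raddfMz /= linearZ /= trivZ_mulz mulrC.
have -> : (group_norm gT : R) *: e' w =
          augmentation (group_norm gT) * (e' w : int) by [].
by rewrite augmentation_norm.
Qed.

Lemma has_degree_inj X Y e e' (f : chain_map X Y) s s' :
  augments e -> has_degree e e' f s -> has_degree e e' f s' -> s = s'.
Proof.
by case=> [[y ey] _] fs fs'; have := fs' y; rewrite fs ey !mul1r.
Qed.

Lemma degree_of_identity X e (f : chain_map X X) s :
  augments e -> has_degree e e f s -> induces f id ->
  exists q, s - 1 = #|gT|%:Z * q.
Proof.
move=> eX fs f1.
have [|_ [_ [w [_ _ _ fw]]]] := zero_on_pi2 (f := cm_sub_id f) eX eX.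
  by move=> x /kernel_lift[z <-]; rewrite /= f1 subrr.
exists (e w).
exact: has_degree_inj eX (has_degree_sub_id fs) fw.
Qed.

Lemma homotopic_to_identity X Y e e' (f : chain_map X Y) (g : chain_map Y X) :
  augments e -> augments e' ->
  has_degree e e' f 1 -> has_degree e' e g 1 ->
  induces (cm_comp g f) id -> chain_homotopic_id f g.
Proof.
move=> eX eY f1 g1 gf.
pose h := cm_sub_id (cm_comp g f).
have h0 : has_degree e e h 0.
  rewrite -(subrr 1) -[X in X - _]mulr1.
  exact/has_degree_sub_id/has_degree_comp.
have [|s0 [s1 [w [h2 h1 hd0 hw]]]] := zero_on_pi2 (f := h) eX eX.
  by move=> x /kernel_lift[z <-]; have := gf z; rewrite /= => ->; rewrite subrr.
have ew : e w = 0.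
  have /eqP := has_degree_inj eX h0 hw.
  rewrite eq_sym mulf_eq0 => /orP[|/eqP //].
  by rewrite eqz_nat -cardsT -leqn0 leqNgt cardG_gt0.
have [v dv] : exists v, a2c_d1 X v = w by apply/(eX.2 _).
have [s0' s0'E] : exists s : {linear a2c_F0 X -> a2c_F1 X},
    s =1 fun x => s0 x + ((group_norm gT : R) *: v) *~ (e x : int).
  apply: equivariant_linear => [x x'|g' x].
    by rewrite !linearD mulrzDr addrACA.
  rewrite trivZ_linear_act linearZ /= scalerDr scalerMzr scalerA.
  by congr (_ + _ *: _); rewrite -[LHS](el_normr g').
exists s0', s1; split=> x.
- rewrite s0'E linearD raddfMz /= linearZ /= dv.
  exact: hd0.
- by rewrite s0'E (aug_d1 eX) mulr0z addr0; apply: h1.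
- exact: h2.
Qed.

(** The composite with an extension of the inverse is the identity on the second
    homotopy module, so its degree is one modulo the order of the group. *)
Lemma degree_unit X Y e e' (f : chain_map X Y)
    (t : {linear pi2 X -> pi2 Y}) (t' : {linear pi2 Y -> pi2 X}) s :
  augments e -> augments e' -> has_degree e e' f s ->
  induces f t -> cancel t t' ->
  exists (g : chain_map Y X) (s' q : int),
    [/\ induces g t', has_degree e' e g s' & s * s' = 1 + #|gT|%:Z * q].
Proof.
move=> eX eY fs ft tt'; have [g gt] := chain_map_extending t'.
have [s' gs] := degree_exists g eY eX.
have gf : induces (cm_comp g f) id by move=> x; rewrite /= ft gt tt'.
have [q qE] := degree_of_identity eX (has_degree_comp fs gs) gf.
by exists g, s', q; split=> //; rewrite -qE addrC subrK.
Qed.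

(** An extension of the inverse has degree one modulo the order of the group,
    hence degree one after a shift; then both composites differ from the
    identity by chain maps vanishing on the second homotopy module and on the
    zeroth homology. *)
Lemma equivalence_of_degree1 X Y e e' (f : chain_map X Y)
    (t : {linear pi2 X -> pi2 Y}) (t' : {linear pi2 Y -> pi2 X}) :
  augments e -> augments e' -> has_degree e e' f 1 ->
  induces f t -> cancel t t' -> cancel t' t ->
  chain_homotopy_equivalent X Y.
Proof.
move=> eX eY f1 ft tt' t't.
have [g [s' [q [gt gs]]]] := degree_unit eX eY f1 ft tt'.
rewrite mul1r => s'E.
have [g' [g't g'1]] := degree_shift (- q) eY eX gt gs.
have {}g'1 : has_degree e' e g' 1.
  by rewrite s'E mulNr [_ * q]mulrC addrK in g'1.
exists f, g'; split.
  by apply: homotopic_to_identity eX eY f1 g'1 _ => x; rewrite /= ft g't tt'.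
by apply: homotopic_to_identity eY eX g'1 f1 _ => x; rewrite /= g't ft t't.
Qed.

(** The two given isomorphisms extend to chain maps through [W] whose degrees are
    units; an automorphism of the second homotopy module of [W] compensates
    their product. *)
Lemma equivalent_of_degrees W e (X Y : alg2complex gT) :
  augments e ->
  (forall (r : nat) (s q : int), r%:Z * s = 1 + #|gT|%:Z * q ->
    exists (f : chain_map W W) (t t' : {linear pi2 W -> pi2 W}),
      [/\ induces f t, cancel t t', cancel t' t & has_degree e e f r%:Z]) ->
  lmod_iso (pi2 X) (pi2 W) -> lmod_iso (pi2 W) (pi2 Y) ->
  chain_homotopy_equivalent X Y.
Proof.
move=> eW degW /lmod_isoP[t1 [t1' [t1K t1'K]]] /lmod_isoP[t2 [t2' [t2K t2'K]]].
have [eX eXP] := augments_exists X; have [eY eYP] := augments_exists Y.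
have [f1 f1t] := chain_map_extending t1; have [f2 f2t] := chain_map_extending t2.
have [s1 f1s] := degree_exists f1 eXP eW.
have [s2 f2s] := degree_exists f2 eW eYP.
have [_ [s1' [q1 [_ _ s1E]]]] := degree_unit eXP eW f1s f1t t1K.
have [_ [s2' [q2 [_ _ s2E]]]] := degree_unit eW eYP f2s f2t t2K.
pose N := #|gT|%:Z.
have N_gt0 : 0 < N by rewrite ltz_nat -cardsT cardG_gt0.
(* [r] represents the inverse of [s1 * s2] modulo the order of the group. *)
pose r := `|modz (s1' * s2') N|%N.
have rE : r%:Z = s1' * s2' - divz (s1' * s2') N * N.
  rewrite [X in X - _](divz_eq _ N) addrC addKr gez0_abs //.
  by rewrite modz_ge0 // gt_eqF.
pose q := q1 + q2 + N * q1 * q2 - divz (s1' * s2') N * (s1 * s2).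
have rs : r%:Z * (s1 * s2) = 1 + N * q.
  have -> : r%:Z * (s1 * s2) =
      (s1 * s1') * (s2 * s2') - N * (divz (s1' * s2') N * (s1 * s2)).
    by rewrite rE; ring.
  by rewrite s1E s2E /q -/N; ring.
have [f [t [t' [ft tK t'K fr]]]] := degW _ _ _ rs.
have F_deg := has_degree_comp (has_degree_comp f1s fr) f2s.
have Ft := induces_comp (induces_comp f1t ft) f2t.
have [F' [F't F'1]] := degree_shift (- q) eXP eYP Ft F_deg.
have {}F'1 : has_degree eX eY F' 1.
  move: F'1; rewrite -/N (_ : _ + _ = 1) //.
  have -> : s1 * r%:Z * s2 = r%:Z * (s1 * s2) by ring.
  by rewrite rs; ring.
apply: (@equivalence_of_degree1 _ _ _ _ _ (t2 \o (t \o t1)) (t1' \o (t' \o t2'))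
          eXP eYP F'1 F't).
  by move=> x; rewrite /= t2K tK t1K.
by move=> x; rewrite /= t1'K t'K t2'K.
Qed.

End Complexes.

(** * Identities in a dihedral group ring *)

Section Geometric.
Variable S : nzRingType.

Definition geo (x : S) (q : nat) : S := \sum_(i < q) x ^+ i.

Lemma geoD x q q' : geo x (q + q') = geo x q + x ^+ q * geo x q'.
Proof.
rewrite /geo big_split_ord /= mulr_sumr; congr (_ + _).
by apply: eq_bigr => i _; rewrite exprD.
Qed.

Lemma geoM x q q' : geo x (q * q') = geo x q * geo (x ^+ q) q'.
Proof.
elim: q' => [|q' IH]; first by rewrite muln0 /geo !big_ord0 mulr0.
rewrite mulnS addnC geoD IH -addn1 geoD mulrDr; congr (_ + _).
rewrite /geo big_ord1 expr0 mulr1 -exprM.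
by apply: commr_sum => i _; apply/commrX/commr_sym/commrX.
Qed.

Lemma geo1 q : geo 1 q = q%:R.
Proof.
rewrite /geo (eq_bigr (fun=> 1)) => [|i _]; last exact: expr1n.
by rewrite sumr_const card_ord.
Qed.

Lemma subr1_geo x q : x ^+ q - 1 = (x - 1) * geo x q.
Proof. exact: subrX1. Qed.

End Geometric.

Section DihedralRing.
Variables (S : nzRingType) (x y : S) (n : nat).
Hypotheses (n_gt0 : (0 < n)%N) (xn : x ^+ n = 1) (y2 : y * y = 1)
  (xyx : x * y * x = y).

Local Notation x' := (x ^+ n.-1).
Local Notation t := (y * x).
Local Notation sigma := (geo x n).

Lemma dih_xV : x * x' = 1. Proof. by rewrite -exprS prednK. Qed.
Lemma dih_Vx : x' * x = 1. Proof. by rewrite -exprSr prednK. Qed.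

Lemma dih_yx : y * x = x' * y.
Proof. by rewrite -[in RHS]xyx !mulrA dih_Vx mul1r. Qed.

Lemma dih_yV : y * x' = x * y.
Proof. by rewrite -[in LHS]xyx -!mulrA dih_xV mulr1. Qed.

Lemma dih_xt : x * t = y. Proof. by rewrite mulrA. Qed.

Lemma dih_t2 : t * t = 1.
Proof. by rewrite -mulrA dih_xt y2. Qed.

Lemma dih_tx : t * x = x' * t.
Proof. by rewrite {1}dih_yx -mulrA. Qed.

Lemma dih_tV : t * x' = x * t.
Proof. by rewrite dih_xt -mulrA dih_xV mulr1. Qed.

Lemma conj_exp (z u v : S) i : z * u = v * z -> z * u ^+ i = v ^+ i * z.
Proof.
move=> zu; elim: i => [|i IH]; first by rewrite mulr1 mul1r.
by rewrite exprSr mulrA IH -mulrA zu mulrA -exprSr.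
Qed.

Lemma sigmax : x * sigma = sigma.
Proof.
apply/eqP; rewrite -subr_eq0 -{2}[sigma]mul1r -mulrBl -subr1_geo xn.
by rewrite subrr.
Qed.

Lemma comm_geo (z : S) q : x * z = z * x -> geo x q * z = z * geo x q.
Proof.
move=> xz; apply/commr_sym; rewrite /geo; apply: commr_sum => i _.
exact/commrX.
Qed.

Lemma exp_xV m i : (i <= m)%N -> x ^+ m * x' ^+ i = x ^+ (m - i).
Proof.
move=> im; rewrite -{1}(subnK im) exprD -mulrA -exprMn_comm.
  by rewrite dih_xV expr1n mulr1.
exact/commrX.
Qed.

Lemma rev_geo m : \sum_(i < m) x ^+ m * x' ^+ i.+1 = geo x m.
Proof.
rewrite /geo [RHS](reindex_inj rev_ord_inj) /=.
by apply: eq_bigr => i _; rewrite exp_xV.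
Qed.

Lemma sigma_y : y * sigma = sigma * y.
Proof.
rewrite mulr_sumr; under eq_bigr => i _ do rewrite (conj_exp _ dih_yx).
rewrite -mulr_suml.
congr (_ * _); rewrite -[RHS]sigmax -rev_geo mulr_sumr.
by apply: eq_bigr => i _; rewrite xn mul1r exprS mulrA dih_xV mul1r.
Qed.

Lemma xsigma : sigma * x = sigma.
Proof. by rewrite comm_geo // sigmax. Qed.

Lemma sigma_t : t * sigma = sigma * t.
Proof. by rewrite -mulrA sigmax mulrA -sigma_y -mulrA xsigma. Qed.

Section Unit.
Variable j : nat.

Let c := \sum_(i < j) x ^+ i.+1.
Let cbar := \sum_(i < j) x' ^+ i.+1.
Let u := 1 + c + cbar.
Let A := c * (1 - t).

Lemma comm_c_cbar : c * cbar = cbar * c.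
Proof.
apply: commr_sum => i _; apply/commr_sym/commr_sum => k _.
by rewrite -exprM; apply/commrX/commr_sym/commrX.
Qed.

Lemma t_c : t * c = cbar * t.
Proof.
rewrite mulr_sumr mulr_suml; apply: eq_bigr => i _.
exact: conj_exp dih_tx.
Qed.

Lemma t_cbar : t * cbar = c * t.
Proof.
rewrite mulr_sumr mulr_suml; apply: eq_bigr => i _.
exact: conj_exp dih_tV.
Qed.

(** [A] is quadratic over the centre, with trace [c + cbar] and norm zero; this
    is why [u - A] inverts [1 + A] up to the central factor [u]. *)
Lemma A2 : A * A = (c + cbar) * A.
Proof.
have tcA : (1 - t) * A = (c + cbar) * (1 - t).
  rewrite /A mulrA mulrBl mul1r t_c 2!mulrBr !mulr1 mulrBl -mulrA dih_t2 mulr1.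
  by rewrite opprB addrACA [- _ - _]addrC -opprD -mulrDl.
rewrite {1}/A -mulrA tcA !mulrA; congr (_ * _).
by rewrite mulrDr mulrDl comm_c_cbar.
Qed.

(** [u] is [1 + x + ... + x ^ (2 * j)] made symmetric by a power of [x]. *)
Lemma x_u : x ^+ j * u = geo x j.*2.+1.
Proof.
have cE : c = x * geo x j.
  by rewrite mulr_sumr; apply: eq_bigr => i _; rewrite exprS.
have cbarE : x ^+ j * cbar = geo x j by rewrite -rev_geo mulr_sumr.
rewrite -addnn -addnS -add1n !geoD [geo x 1]/geo big_ord1 expr0 expr1 -cE.
by rewrite mulrDr cbarE addrC.
Qed.

Lemma comm_xu : x * u = u * x.
Proof.
apply: commrD; first apply: commrD; first exact: commr1.
  by apply: commr_sum => i _; apply/commrX.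
by apply: commr_sum => i _; apply/commrX/commrX.
Qed.

Lemma comm_tu : t * u = u * t.
Proof.
by rewrite /u !mulrDr !mulrDl mulr1 mul1r t_c t_cbar -!addrA [_ + c * t]addrC.
Qed.

Lemma comm_cu : c * u = u * c.
Proof.
apply/commr_sym/commr_sum => i _; apply/commrX.
exact/commr_sym/comm_xu.
Qed.

Lemma comm_Au : A * u = u * A.
Proof.
have tu : (1 - t) * u = u * (1 - t) by rewrite mulrBl mulrBr mul1r mulr1 comm_tu.
by rewrite /A -mulrA tu !mulrA comm_cu.
Qed.

Lemma comm_sigmaA : sigma * A = A * sigma.
Proof.
have tS : (1 - t) * sigma = sigma * (1 - t).
  by rewrite mulrBl mulrBr mul1r mulr1 sigma_t.
rewrite /A -[RHS]mulrA tS !mulrA; congr (_ * _).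
by apply: commr_sum => i _; apply/commrX; rewrite /GRing.comm xsigma sigmax.
Qed.

Lemma uA1 : (1 + A) * (u - A) = u.
Proof.
rewrite mulrDl mul1r mulrBr A2 comm_Au -mulrBl /u -[1 + c + _]addrA addrK.
by rewrite mul1r subrK.
Qed.

Lemma uAA : (u - A) * A = A.
Proof. by rewrite mulrBl A2 -mulrBl /u -[1 + c + _]addrA addrK mul1r. Qed.

Lemma A1A : A * (1 + A) = u * A.
Proof. by rewrite mulrDr mulr1 A2 /u -[1 + c + _]addrA [RHS]mulrDl mul1r. Qed.

(** Up to a power of [x], with [r = 2 * j + 1], [u] is the quotient of
    [x ^ r - 1] by [x - 1], and its inverse modulo [sigma] is the quotient of
    [x ^ (r * s) - 1] by [x ^ r - 1]. *)
Lemma u_inverse s z : (j.*2.+1 * s = 1 + n * z)%N ->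
  exists v, [/\ u * v = 1 + sigma *+ z, v * u = 1 + sigma *+ z
               & sigma * v = v * sigma].
Proof.
move=> rs; pose w := geo (x ^+ j.*2.+1) s.
have ux : u * x ^+ j = x ^+ j * u by apply/commrX/commr_sym/comm_xu.
have E : geo x (j.*2.+1) * w = 1 + sigma *+ z.
  rewrite /w -geoM rs geoD geoM xn geo1 expr1 mulrA sigmax.
  by rewrite [geo x 1]/geo big_ord1 expr0 mulr_natr.
have uw : u * w = w * u.
  apply: commr_sum => i _; apply/commrX/commrX/commr_sym; exact: comm_xu.
have sw : sigma * w = w * sigma.
  by apply: commr_sum => i _; apply/commrX/commrX; rewrite /GRing.comm xsigma sigmax.
exists (x ^+ j * w); split.
- by rewrite mulrA ux x_u.
- by rewrite -mulrA -uw mulrA x_u.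
have sx : sigma * x ^+ j = x ^+ j * sigma.
  by apply/commrX; rewrite /GRing.comm xsigma sigmax.
by rewrite mulrA sx -[LHS]mulrA sw mulrA.
Qed.

End Unit.

(** The element [w] is the chain map in degree zero, [p = 1 + c * (1 - y * x)]
    the coefficient of its lift on the generators attached to [x] and to
    the relator [x ^ n].  With [v] inverse to [u] modulo [sigma], the inverse of
    [p] on the possible first coordinates of an element of the kernel is
    [p' = 1 - (u - A) * v * A]. *)
Lemma dihedral_units j s z : (j.*2.+1 * s = 1 + n * z)%N ->
  let w := 1 + (\sum_(i < j) x ^+ i.+1) * (1 + y) in
  exists p p' : S,
  [/\ w * (x - 1) = (x - 1) * p, w * (y - 1) = y - 1, p * (1 + t) = 1 + t,
      p * sigma = sigma * p
    & forall v, (1 - t) * (sigma * v) = 0 ->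
      [/\ sigma * (p * v) = sigma * v, sigma * (p' * v) = sigma * v,
          p * (p' * v) = v & p' * (p * v) = v]].
Proof.
move=> rs; have [v [uv vu sv]] := u_inverse rs.
set c := \sum_(i < j) x ^+ i.+1 => w.
pose A := c * (1 - t).
set u := 1 + c + \sum_(i < j) x' ^+ i.+1 in uv vu.
have cx : c * (x - 1) = (x - 1) * c.
  rewrite mulrBr mulrBl mulr1 mul1r; congr (_ - _).
  by apply/commr_sym/commr_sum => i _; apply/commrX.
exists (1 + A), (1 - (u - A) * v * A); split.
- have yx1 : (1 + y) * (x - 1) = (x - 1) * (1 - t).
    rewrite mulrBr mulr1 mulrDl mul1r mulrBl mulrBr mulr1 dih_xt mul1r.
    by rewrite opprB [RHS]addrACA opprD [- 1 - y]addrC.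
  by rewrite /w mulrDl mul1r -mulrA yx1 mulrA cx [RHS]mulrDr mulr1 /A !mulrA.
- rewrite /w mulrDl mul1r -mulrA mulrDl mul1r mulrBr y2 mulr1.
  by rewrite addrA subrK subrr mulr0 addr0.
- rewrite mulrDl mul1r /A -mulrA mulrDr mulr1 mulrBl mul1r dih_t2.
  by rewrite addrA subrK subrr mulr0 addr0.
- by rewrite mulrDl mulrDr mul1r mulr1 comm_sigmaA.
move=> q tq.
have Aq : A * (sigma * q) = 0 by rewrite /A -mulrA tq mulr0.
have sA : sigma * (A * q) = 0 by rewrite mulrA comm_sigmaA -mulrA.
have su : sigma * (u - A) = (u - A) * sigma.
  have sP i w0 : (w0 == x) || (w0 == x') -> sigma * w0 ^+ i = w0 ^+ i * sigma.
    move=> w0x; apply/commrX; rewrite /GRing.comm.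
    case/orP: w0x => /eqP ->; first by rewrite xsigma sigmax.
    by apply/commrX; rewrite /GRing.comm xsigma sigmax.
  rewrite mulrBr mulrBl comm_sigmaA; congr (_ - _).
  rewrite /u; apply: commrD; first apply: commrD; first exact: commr1.
    by apply: commr_sum => i _; apply: sP; rewrite eqxx.
  by apply: commr_sum => i _; apply: sP; rewrite eqxx orbT.
have Au_1 : (1 + A) * (u - A) = u := uA1 j.
have uA_A : (u - A) * A = A := uAA j.
have A_1A : A * (1 + A) = u * A := A1A j.
clear Aq tq cx; clearbody A u; clear w.
have sAq : sigma * ((1 + A) * q) = sigma * q.
  by rewrite mulrDl mul1r mulrDr sA addr0.
have sBq : sigma * ((u - A) * v * A * q) = 0.
  rewrite -!mulrA mulrA su -mulrA [sigma * (v * _)]mulrA sv.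
  by rewrite -[v * sigma * _]mulrA sA !mulr0.
split=> //.
- by rewrite mulrBl mul1r mulrBr sBq subr0.
- have -> : (1 - (u - A) * v * A) * q = q - (u - A) * (v * (A * q)).
    by rewrite mulrBl mul1r !mulrA.
  rewrite mulrBr [_ * (_ * (v * _))]mulrA Au_1 [u * _]mulrA uv !mulrDl !mul1r.
  by rewrite mulrnAl sA mul0rn addr0 addrK.
rewrite [_ * ((1 + A) * q)]mulrA mulrBl mul1r -[_ * v * A * _]mulrA A_1A.
rewrite -[_ * v * _]mulrA [v * _]mulrA vu mulrBl.
have -> : (u - A) * ((1 + sigma *+ z) * A) * q = (u - A) * (A * q).
  by rewrite -!mulrA [(1 + _) * _]mulrDl mul1r mulrnAl sA mul0rn addr0.
by rewrite mulrA uA_A mulrDl mul1r addrK.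
Qed.

End DihedralRing.

(** * The group ring of the dihedral group *)

Section DihedralGroup.
Variables (gT : finGroupType) (n : nat) (a b : gT).
Hypotheses (n_gt0 : (0 < n)%N) (hG : dihedral_presentation n a b).
Local Notation ZG := (intgr gT).
Local Notation el := (@intgr_of gT).

(** Bounding a presented group from below takes a model: the dihedral group of
    order [4 * n] satisfies the relations, so it is an image of [gT]. *)
Lemma card_dihedral_ge : (4 * n <= #|gT|)%N.
Proof.
have [hp _ _ _ _] := hG.
have q_gt1 : (1 < 2 * n)%N by case: n n_gt0 => // k _; rewrite mulnS.
have : ([set: 'D_(2 * n).*2] \homg [set: gT])%g.
  rewrite hp; have := homg_refl [set: 'D_(2 * n).*2]%g.
  rewrite (Grp_dihedral q_gt1) => /existsP[[x y]] /= /eqP[gen x1 y1 xy].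
  apply/existsP; exists (x, y); rewrite /= !xpair_eqE gen x1 y1 !eqxx /=.
  by rewrite {1}(conjgC x y) xy mulgKV.
move/card_homg => /dvdn_leq; rewrite card_dihedral // cardsT.
rewrite -muln2 mulnC mulnA => -> //.
by rewrite -cardsT cardG_gt0.
Qed.

Definition dih_elt (p : 'I_(2 * n) * bool) : gT := (a ^+ p.1 * b ^+ p.2)%g.

Lemma dih_elt_surj g : exists p, dih_elt p = g.
Proof.
have [_ gen a2n b2 aba] := hG.
have N2 : (0 < 2 * n)%N by rewrite muln_gt0.
have gP : g \in (<[a]> * <[b]>)%g.
  have nab : (<[b]> \subset 'N(<[a]>))%g.
    rewrite cycle_subG; apply/normP; rewrite -cycleJ.
    have -> : (a ^ b = a^-1)%g.
      rewrite conjgE -[(a * b)%g](mulgK a) aba mulKg //.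
    by rewrite cycleV.
  rewrite -norm_joinEr // joing_idl joing_idr.
  by rewrite [(_ <*> _)%g]gen inE.
have /imset2P[_ _ /cycleP[i ->] /cycleP[k ->] ->] := gP.
exists (Ordinal (ltn_pmod i N2), odd k); rewrite /dih_elt /=; congr (_ * _)%g.
  by rewrite expg_mod.
by rewrite -modn2 expg_mod.
Qed.

(** These products exhaust the group, so its order forces them to be distinct. *)
Lemma dih_elt_inj : injective dih_elt.
Proof.
have /image_injP inj : #|image dih_elt predT| == #|{: 'I_(2 * n) * bool}|.
  rewrite eqn_leq leq_image_card /= card_prod card_ord card_bool.
  have -> : #|image dih_elt predT| = #|gT|.
    apply: eq_card => g; rewrite inE; apply/imageP.
    by have [p <-] := dih_elt_surj g; exists p.
  by rewrite mulnC mulnA card_dihedral_ge.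
by move=> p q; apply: inj.
Qed.

Lemma sum_dihedral (V : nmodType) (F : gT -> V) :
  \sum_g F g = \sum_(i < 2 * n) (F (a ^+ i)%g + F (a ^+ i * b)%g).
Proof.
rewrite (reindex dih_elt) /=; last first.
  pose r g := sval (cid (dih_elt_surj g)).
  have rK : cancel r dih_elt by move=> g; rewrite /r; case: cid.
  by exists r => // p _; apply: dih_elt_inj; rewrite rK.
rewrite -(pair_bigA _ (fun i e => F (dih_elt (i, e)))) /=.
apply: eq_bigr => i _; rewrite big_bool addrC.
by rewrite /dih_elt /= mulg1.
Qed.

Lemma card_dihedral_eq : #|gT| = (4 * n)%N.
Proof.
have := sum_dihedral (fun=> 1%N).
rewrite sum1_card => ->; rewrite sum_nat_const card_ord.
by rewrite mulnC mulnA.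
Qed.

Local Notation x := (el a).
Local Notation y := (el b).
Local Notation sigma := (geo x (2 * n)).

Lemma dih_x : x ^+ (2 * n) = 1.
Proof. by have [_ _ a2n _ _] := hG; rewrite -elX a2n. Qed.

Lemma dih_y : y * y = 1.
Proof. by have [_ _ _ b2 _] := hG; rewrite -[RHS](congr1 el b2) elX expr2. Qed.

Lemma dih_xyx : x * y * x = y.
Proof. by have [_ _ _ _ aba] := hG; rewrite !elM aba. Qed.

Lemma sigma_aE : sigma_a n a = sigma.
Proof. by apply: eq_bigr => i _; rewrite elX. Qed.

Lemma intgr_closed (P : ZG -> Prop) :
  P 0 -> (forall u v, P u -> P v -> P (u + v)) -> (forall u, P u -> P (- u)) ->
  (forall g, P (el g)) -> forall u, P u.
Proof.
move=> P0 PD PN Pg u; rewrite (intgr_expand u).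
apply: big_ind => // g _.
have Pn k : P (el g *+ k) by elim: k => // k IH; rewrite mulrS; apply: PD.
by case: (u g) => k; [exact: Pn | rewrite NegzE mulrNz; apply/PN/Pn].
Qed.

Lemma intgr_dih_closed (P : ZG -> Prop) :
  P 0 -> (forall u v, P u -> P v -> P (u + v)) -> (forall u, P u -> P (- u)) ->
  (forall i, P (x ^+ i)) -> (forall i, P (x ^+ i * y)) -> forall u, P u.
Proof.
move=> P0 PD PN P1 P2; apply: intgr_closed => // g.
have [[i []] <-] := dih_elt_surj g; rewrite /dih_elt /= -elM elX //.
by rewrite (_ : el (b ^+ false) = 1) // mulr1.
Qed.

Lemma reduce_y (u : ZG) :
  exists (v w : ZG) (z : int), u = (1 + y) * v + (x - 1) * w + 1 *~ z.
Proof.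
have N2 : (0 < 2 * n)%N by rewrite muln_gt0.
have P1 i : exists (v w : ZG) (z : int),
    x ^+ i = (1 + y) * v + (x - 1) * w + 1 *~ z.
  by exists 0, (geo x i), 1; rewrite mulr0 add0r -subr1_geo subrK.
elim/intgr_dih_closed: u => [|u v|u|i|i].
- by exists 0, 0, 0; rewrite !mulr0 mulr0z !addr0.
- move=> [v1 [w1 [z1 ->]]] [v2 [w2 [z2 ->]]].
  exists (v1 + v2), (w1 + w2), (z1 + z2).
  rewrite mulrzDr addrACA [_ * (v1 + _)]mulrDr [_ * (w1 + _)]mulrDr.
  by rewrite [X in X + _]addrACA.
- move=> [v1 [w1 [z1 ->]]]; exists (- v1), (- w1), (- z1).
  by rewrite !mulrN mulrNz !opprD.
- exact: P1.
have [v [w [z e]]] := P1 ((2 * n).-1 * i)%N.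
exists (x ^+ ((2 * n).-1 * i) - v), (- w), (- z).
rewrite mulrBr mulrN mulrNz -addrA -opprD -addrA -opprD addrA -e.
rewrite mulrDl mul1r addrC addKr exprM; apply: esym.
by apply: conj_exp; apply: dih_yV => //; [exact: dih_x | exact: dih_xyx].
Qed.

Lemma augmentation_ideal (u : ZG) :
  exists v w : ZG, u = (x - 1) * v + (y - 1) * w + 1 *~ augmentation u.
Proof.
have e0 : augmentation (0 : ZG) = 0.
  by rewrite -[X in augmentation X](subrr (0 : ZG)) augmentationB subrr.
have augN (s : ZG) : augmentation (- s) = - augmentation s.
  by rewrite -sub0r augmentationB e0 sub0r.
elim/intgr_dih_closed: u => [|u v|u|i|i].
- by exists 0, 0; rewrite !mulr0 e0 mulr0z !addr0.
- move=> [v1 [w1 e1]] [v2 [w2 e2]]; exists (v1 + v2), (w1 + w2).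
  rewrite augmentationD mulrzDr {1}e1 {1}e2.
  rewrite addrACA [_ * (v1 + _)]mulrDr [_ * (w1 + _)]mulrDr.
  by rewrite [X in X + _]addrACA.
- move=> [v [w e]]; exists (- v), (- w).
  by rewrite augN // mulrNz !mulrN -!opprD -e.
- exists (geo x i), 0.
  by rewrite mulr0 addr0 -elX augmentation_el elX -subr1_geo subrK.
exists (geo x i * y), 1.
rewrite -elX elM augmentation_el -elM elX mulrA -subr1_geo mulrBl mul1r mulr1.
by rewrite addrA !subrK.
Qed.

Lemma invariant_sigma (u : ZG) : x * u = u -> exists v, u = sigma * v.
Proof.
move=> xu; exists (1 *~ u 1%g + y *~ u b).
have ux g : u (a * g)%g = u g.
  rewrite -{1}xu ffunE (bigD1 a) //= big1 => [|h /negPf ha].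
    by rewrite ffunE eqxx mul1r addr0 mulKg.
  by rewrite ffunE ha mul0r.
have uX i g : u (a ^+ i * g)%g = u g.
  by elim: i => [|i IH]; rewrite ?mul1g // expgS -mulgA ux.
rewrite {1}(intgr_expand u) sum_dihedral mulr_suml; apply: eq_bigr => i _.
rewrite -[X in u X](mulg1 (a ^+ i)%g) !uX mulrDr -elM elX.
by rewrite !mulrzAr mulr1.
Qed.

(** Multiplication by [sigma] kills [x - 1], and [sigma * (y - 1)] has coefficient
    [-1] at the identity since [b] is not a rotation. *)
Lemma integer_not_ideal (v : ZG) (z : int) :
  (x - 1) * v + (y - 1) *~ z = 0 -> z = 0.
Proof.
have N2 : (0 < 2 * n)%N by rewrite muln_gt0.
have sx1 : sigma * (x - 1) = 0.
  by rewrite mulrBr mulr1 (xsigma dih_x) subrr.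
move/(congr1 (fun u => sigma * u)); rewrite mulrDr mulrA sx1 mul0r add0r mulr0.
rewrite mulrzAr => /(congr1 (fun u : ZG => u 1%g)); rewrite intgr_coefMz.
have one_elt : 1%g = dih_elt (Ordinal N2, false) by rewrite /dih_elt /= mulg1.
have dih1 (i : 'I_(2 * n)) e :
    (1%g == (a ^+ i * b ^+ nat_of_bool e)%g) = (i == Ordinal N2) && ~~ e.
  rewrite [X in X == _]one_elt -[(_ * _)%g]/(dih_elt (i, e)).
  rewrite (inj_eq dih_elt_inj) xpair_eqE eq_sym; congr (_ && _).
have -> : (sigma * (y - 1)) 1%g = -1.
  rewrite mulrBr mulr1 mulr_suml 2!ffunE !intgr_coef_sum.
  rewrite big1 => [|i _]; last first.
    by rewrite -elX elM ffunE (dih1 i true) andbF.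
  rewrite (bigD1 (Ordinal N2)) //= big1 => [|i /negPf i0].
    by rewrite expr0 ffunE eqxx addr0 sub0r.
  by rewrite -elX ffunE -[(a ^+ i)%g]mulg1 (dih1 i false) i0.
by rewrite ffunE mulNrz intz => /eqP; rewrite oppr_eq0 => /eqP.
Qed.

End DihedralGroup.

(** * The Cayley complex and its self-maps *)

Section FirstCoordinate.
Variables (gT : finGroupType) (r : nat) (p : intgr gT).
Local Notation R := (intgr gT)^c.

(** The product is taken in the group ring and not in its converse: acting on the
    left is what commutes with the right module structure. *)
Definition mul_first (v : 'rV[R]_r.+1) : 'rV[R]_r.+1 :=
  \row_j (if j == ord0 then p * (v ord0 ord0 : intgr gT) else v ord0 j).

Fact mul_first_linear : linear mul_first.
Proof.
move=> s u v; apply/rowP=> j; rewrite !mxE; case: eqP => // _.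
have E (q q' : R) : q * q' = (q' : intgr gT) * (q : intgr gT) by [].
by rewrite mulrDr !E mulrA.
Qed.

HB.instance Definition _ :=
  GRing.isLinear.Build R _ _ *:%R mul_first mul_first_linear.

Lemma mul_first0 v : mul_first v ord0 ord0 = p * (v ord0 ord0 : intgr gT).
Proof. by rewrite mxE eqxx. Qed.

Lemma mul_firstS v j : j != ord0 -> mul_first v ord0 j = v ord0 j.
Proof. by rewrite mxE => /negPf ->. Qed.

End FirstCoordinate.

Section Cayley.
Variables (gT : finGroupType) (n : nat) (a b : gT) (k : nat).
Hypotheses (n_gt0 : (0 < n)%N) (hG : dihedral_presentation n a b).
Local Notation ZG := (intgr gT).
Local Notation R := (ZG)^c.
Local Notation el := (@intgr_of gT).
Local Notation x := (el a).
Local Notation y := (el b).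
Local Notation t := (y * x).
Local Notation sigma := (geo x (2 * n)).

Let o30 : 'I_3 := ord0.
Let o31 : 'I_3 := @Ordinal 3 1 isT.
Let o32 : 'I_3 := @Ordinal 3 2 isT.
Let o20 : 'I_2 := ord0.
Let o21 : 'I_2 := @Ordinal 2 1 isT.
Let i0 : 'I_1 := ord0.

Let sum3 (V : nmodType) (F : 'I_3 -> V) : \sum_i F i = F o30 + F o31 + F o32.
Proof.
rewrite !big_ord_recl big_ord0 addr0 addrA; congr (F _ + F _ + F _);
  exact: val_inj.
Qed.

Let sum2 (V : nmodType) (F : 'I_2 -> V) : \sum_i F i = F o20 + F o21.
Proof.
by rewrite !big_ord_recl big_ord0 addr0; congr (F _ + F _); apply: val_inj.
Qed.

Let revM (p q : R) : p * q = (q : ZG) * (p : ZG). Proof. by []. Qed.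

Lemma J_d2_0 (v : 'rV[R]_3) :
  J_d2 n a b v i0 o20 = sigma * (v i0 o30 : ZG) + (1 + t) * (v i0 o32 : ZG) :> ZG.
Proof.
rewrite /J_d2 /= mxE sum3 !mxE /J_bd /= sigma_aE elM.
by rewrite !revM mul0r addr0.
Qed.

Lemma J_d2_1 (v : 'rV[R]_3) :
  J_d2 n a b v i0 o21
  = (1 + y) * (v i0 o31 : ZG) + (x - 1) * (v i0 o32 : ZG) :> ZG.
Proof.
rewrite /J_d2 /= mxE sum3 !mxE /J_bd /=.
by rewrite !revM mul0r add0r.
Qed.

Definition cayley_mx : 'M[R]_(2, 1) :=
  \col_i (if i == o20 then x - 1 else y - 1).

Definition cayley_d1 : {linear 'rV[R]_2 -> 'rV[R]_1} := mulmxr cayley_mx.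

Definition cayley_d2 : {linear ('rV[R]_3 * 'rV[R]_k)%type -> 'rV[R]_2} :=
  J_d2 n a b \o fst.

Lemma cayley_d1E (v : 'rV[R]_2) :
  cayley_d1 v i0 i0
  = (x - 1) * (v i0 o20 : ZG) + (y - 1) * (v i0 o21 : ZG) :> ZG.
Proof. by rewrite /cayley_d1 /= mxE sum2 !mxE /= !revM. Qed.

Lemma y_sub1_add1 : (y - 1) * (1 + y) = 0.
Proof.
rewrite mulrDr mulr1 mulrBl mul1r (dih_y hG).
by rewrite addrA subrK subrr.
Qed.

Lemma cayley_relation : (x - 1) * (1 + t) + (y - 1) * (x - 1) = 0.
Proof.
rewrite mulrDr mulr1 mulrBl mul1r mulrA (dih_xyx hG).
rewrite mulrBl mul1r mulrBr mulr1 -[t - y]opprB -opprD.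
by rewrite [X in _ - X]addrC subrr.
Qed.

Lemma t_sub1_add1 : (1 - t) * (1 + t) = 0.
Proof.
rewrite mulrDr mulr1 mulrBl mul1r (dih_t2 (dih_y hG) (dih_xyx hG)).
by rewrite addrA subrK subrr.
Qed.

Lemma cayley_complex v : cayley_d1 (cayley_d2 v) = 0.
Proof.
apply/rowP=> i; rewrite (ord1 i) [RHS]mxE cayley_d1E /cayley_d2 /=.
rewrite J_d2_0 J_d2_1 !mulrDr !mulrA y_sub1_add1 mul0r add0r.
have -> : (x - 1) * sigma = 0.
  by rewrite mulrBl mul1r (sigmax (dih_x hG)) subrr.
by rewrite mul0r add0r -mulrDl cayley_relation mul0r.
Qed.

(** Boundaries of the last two generators reduce the second coordinate of a cycle
    to an integer, which must vanish modulo the rotations; the first coordinate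
    is then invariant under the rotations, hence a boundary. *)
Lemma cayley_exact (v : 'rV[R]_2) :
  cayley_d1 v = 0 <-> exists w, cayley_d2 w = v.
Proof.
split=> [|[w <-]]; last exact: cayley_complex.
move=> /(congr1 (fun u : 'rV[R]_1 => u i0 i0)); rewrite cayley_d1E mxE.
have [v1 [v2 [z e]]] := reduce_y n_gt0 hG (v i0 o21).
rewrite e !mulrDr !mulrA y_sub1_add1 mul0r add0r mulrzAr mulr1.
have -> : (y - 1) * (x - 1) = - ((x - 1) * (1 + t)).
  by apply/eqP; rewrite -addr_eq0 addrC cayley_relation.
rewrite mulNr -mulrA addrA -mulrBr => E.
have z0 := integer_not_ideal n_gt0 hG E.
rewrite z0 mulr0z addr0 in E; rewrite z0 mulr0z addr0 in e.
have /(invariant_sigma n_gt0 hG)[v0 e0] :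
    x * ((v i0 o20 : ZG) - (1 + t) * v2) = (v i0 o20 : ZG) - (1 + t) * v2.
  by rewrite -[RHS]mul1r; apply/eqP; rewrite -subr_eq0 -mulrBl E.
pose w : 'rV[R]_3 :=
  \row_i (if i == o30 then v0 else if i == o31 then v1 else v2).
exists (w, 0); apply/rowP=> i; rewrite /cayley_d2 /=.
have [->|->] : i = o20 \/ i = o21.
- by case: i => [[|[|//]] lti]; [left | right]; apply: val_inj.
- by rewrite J_d2_0 !mxE /= -e0 subrK.
- by rewrite J_d2_1 !mxE /= -e.
Qed.

Lemma cayley_aug_exists :
  exists eps : {linear 'rV[R]_1 -> trivZ gT},
    eps =1 fun v => augmentation (v i0 i0 : ZG).
Proof.
apply: equivariant_linear => [u v|g v]; first by rewrite mxE augmentationD.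
by rewrite mxE revM augmentationM augmentation_el mulr1 trivZ_act.
Qed.

Lemma cayley_aug (eps : {linear 'rV[R]_1 -> trivZ gT}) :
  (eps =1 fun v => augmentation (v i0 i0 : ZG)) ->
  (exists v, eps v = 1 :> int) /\
  (forall v, eps v = 0 <-> exists w, cayley_d1 w = v).
Proof.
move=> epsE; split=> [|v].
  by exists (const_mx 1); rewrite epsE mxE augmentation1.
split=> [|[w <-]]; rewrite epsE.
  move=> e; have [p [q pq]] := augmentation_ideal n_gt0 hG (v i0 i0).
  exists (\row_i (if i == o20 then p else q)); apply/rowP=> i.
  by rewrite (ord1 i) cayley_d1E !mxE /= pq e mulr0z addr0.
rewrite cayley_d1E augmentationD !augmentationM !augmentationB.
by rewrite !augmentation_el subrr !mul0r.
Qed.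

Lemma free_row r : fg_free 'rV[R]_r.
Proof. by exists r, idfun; exists idfun. Qed.

Lemma free_row_prod r s : fg_free ('rV[R]_r * 'rV[R]_s)%type.
Proof.
exists (r + s)%N.
have [f fE] : exists f : {linear ('rV[R]_r * 'rV[R]_s)%type -> 'rV[R]_(r + s)},
    f =1 fun p => row_mx p.1 p.2.
  apply: linear_of => c [u1 u2] [v1 v2] /=.
  by rewrite scale_row_mx add_row_mx.
apply: (@lmod_iso_of_can _ _ _ f (fun v => (lsubmx v, rsubmx v))) => [[u v]|v].
  by rewrite fE row_mxKl row_mxKr.
by rewrite fE hsubmxK.
Qed.

Lemma cayley_coker : lmod_iso (cokernel cayley_d1) (trivZ gT).
Proof.
have [eps epsE] := cayley_aug_exists; have [[v ev] ker] := cayley_aug epsE.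
apply/coker_isoP; exists eps; split=> // z.
exists (v *~ z); rewrite raddfMz /= trivZ_mulz ev; exact: mul1r.
Qed.

Definition cayley : alg2complex gT :=
  Alg2Complex (free_row_prod 3 k) (free_row 2) (free_row 1)
    cayley_complex cayley_coker cayley_exact.

Lemma pi2_cayley : lmod_iso (pi2 cayley) (J n a b * 'rV[R]_k)%type.
Proof.
have iso := @kernel_fst_iso R _ _ 'rV[R]_k (J_d2 n a b).
have iso' : lmod_iso (kernel cayley_d2) (J n a b * 'rV[R]_k)%type by exact iso.
exact iso'.
Qed.

Lemma J_d2_mul_first (p : ZG) (v : 'rV[R]_3) :
  p * (1 + t) = 1 + t -> p * sigma = sigma * p ->
  mul_first p (J_d2 n a b v) = J_d2 n a b (mul_first p v).
Proof.
move=> pt ps; apply/rowP=> i.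
have [->|->] : i = o20 \/ i = o21.
- by case: i => [[|[|//]] lti]; [left | right]; apply: val_inj.
- by rewrite mul_first0 !J_d2_0 mul_first0 mul_firstS // mulrDr !mulrA pt ps.
- by rewrite mul_firstS // !J_d2_1 !mul_firstS.
Qed.

Lemma J_d2_first_coord (v : 'rV[R]_3) :
  J_d2 n a b v = 0 -> (1 - t) * (sigma * (v i0 o30 : ZG)) = 0.
Proof.
move/(congr1 (fun u : 'rV[R]_2 => u i0 o20)); rewrite J_d2_0 mxE => /eqP.
rewrite addr_eq0 => /eqP ->.
by rewrite mulrN mulrA t_sub1_add1 mul0r oppr0.
Qed.

Lemma J_d2_mul_first_id (p : ZG) (v : 'rV[R]_3) :
  sigma * (p * (v i0 o30 : ZG)) = sigma * (v i0 o30 : ZG) ->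
  J_d2 n a b (mul_first p v) = J_d2 n a b v.
Proof.
move=> e; apply/rowP=> i.
have [->|->] : i = o20 \/ i = o21.
- by case: i => [[|[|//]] lti]; [left | right]; apply: val_inj.
- by rewrite !J_d2_0 mul_first0 mul_firstS // e.
- by rewrite !J_d2_1 !mul_firstS.
Qed.

Lemma mul_first_comp r (p q : ZG) (v : 'rV[R]_r.+1) :
  p * (q * (v ord0 ord0 : ZG)) = v ord0 ord0 ->
  mul_first p (mul_first q v) = v.
Proof.
move=> e; apply/rowP=> i; have [->|i0'] := eqVneq i ord0.
  by rewrite !mul_first0.
by rewrite !mul_firstS.
Qed.

Lemma mul_first_pi2 (p : ZG) (h : {linear ('rV[R]_3 * 'rV[R]_k)%type
                                     -> ('rV[R]_3 * 'rV[R]_k)%type}) :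
  (h =1 fun v => (mul_first p v.1, v.2)) ->
  (forall q : ZG, (1 - t) * (sigma * q) = 0 -> sigma * (p * q) = sigma * q) ->
  exists f : {linear pi2 cayley -> pi2 cayley},
    forall z, \val (f z) = h (\val z).
Proof.
move=> hE pP; apply: kernel_restrict => v fv; rewrite hE -[RHS]fv.
exact: J_d2_mul_first_id (pP _ (J_d2_first_coord fv)).
Qed.

(** Left multiplication by the [w] and [p] of [dihedral_units] on the first
    generators is a chain map of degree [2 * j + 1 = r]; the inverse on the
    second homotopy module is left multiplication by [p']. *)
Lemma cayley_degree (eps : {linear 'rV[R]_1 -> trivZ gT}) (r : nat) (s q : int) :
  (eps =1 fun v => augmentation (v i0 i0 : ZG)) ->
  r%:Z * s = 1 + #|gT|%:Z * q ->
  exists (f : chain_map cayley cayley) (g g' : {linear pi2 cayley -> pi2 cayley}),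
    [/\ induces f g, cancel g g', cancel g' g
      & @has_degree _ cayley cayley eps eps f r%:Z].
Proof.
move=> epsE; rewrite (card_dihedral_eq n_gt0 hG) => rs.
have dvd1 d : (d %| r)%N -> (d %| 4 * n)%N -> d = 1%N.
  move=> dr dn; apply/eqP; rewrite -dvdn1.
  have : (d%:Z %| r%:Z * s - (4 * n)%:Z * q)%Z.
    by rewrite rpredB // dvdz_mulr.
  by rewrite rs addrK.
have r_odd : odd r.
  apply: contraT => /negbTE r_even.
  by have := dvd1 2%N; rewrite dvdn2 r_even -(mulnA 2 2) dvdn_mulr //
    => /(_ isT isT).
have r_gt0 : (0 < r)%N by case: r r_odd {rs dvd1}.
have cop : coprime r (2 * n).
  apply/eqP/dvd1; first exact: dvdn_gcdl.
  by rewrite -(mulnA 2 2); apply/dvdn_mull/dvdn_gcdr.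
have [[s' z] /= sz] := coprimeP _ r_gt0 cop.
pose j := r./2.
have rj : r = j.*2.+1 by rewrite -{1}(odd_double_half r) r_odd.
have js : (j.*2.+1 * s' = 1 + 2 * n * z)%N.
  rewrite -rj mulnC [(_ * z)%N]mulnC -{1}sz subnK //.
  by apply: ltnW; rewrite -subn_gt0 sz.
have N2 : (0 < 2 * n)%N by rewrite muln_gt0.
have [p [p' [wx wy pt ps pP]]] :=
  dihedral_units N2 (dih_x hG) (dih_y hG) (dih_xyx hG) js.
set w := 1 + _ in wx wy.
have d2E (v : 'rV[R]_3 * 'rV[R]_k) :
    mul_first p (cayley_d2 v) = cayley_d2 (mul_first p v.1, v.2).
  exact: J_d2_mul_first.
have d1E v : mul_first w (cayley_d1 v) = cayley_d1 (mul_first p v).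
  apply/rowP=> i; rewrite (ord1 i) mul_first0 !cayley_d1E mul_first0.
  by rewrite mul_firstS // mulrDr !mulrA wx wy.
have [f2 f2E] := @linear_on_fst _ _ 'rV[R]_k (mul_first (r := 2) p).
have [f2' f2'E] := @linear_on_fst _ _ 'rV[R]_k (mul_first (r := 2) p').
have f2d v : mul_first p (cayley_d2 v) = cayley_d2 (f2 v) by rewrite f2E d2E.
pose f : chain_map cayley cayley :=
  @ChainMap _ cayley cayley f2 (mul_first p) (mul_first w) f2d d1E.
have [|g gE] := mul_first_pi2 f2E; first by move=> v /pP[].
have [|g' g'E] := mul_first_pi2 f2'E; first by move=> v /pP[].
have zP (u : pi2 cayley) : (1 - t) * (sigma * ((\val u).1 i0 o30 : ZG)) = 0.
  exact: J_d2_first_coord (kernelP u).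
exists f, g, g'; split=> [u|u|u|v].
- by rewrite gE.
- apply: val_inj; rewrite g'E gE f2'E f2E [RHS]surjective_pairing /=; congr (_, _).
  by apply: mul_first_comp; have [] := pP _ (zP u).
- apply: val_inj; rewrite gE g'E f2E f2'E [RHS]surjective_pairing /=; congr (_, _).
  by apply: mul_first_comp; have [] := pP _ (zP u).
rewrite !epsE /= mul_first0 augmentationM mulrC; congr (_ * _).
rewrite /w augmentationD augmentationM augmentationD augmentation1.
have -> : augmentation (\sum_(i < j) x ^+ i.+1) = j%:Z.
  elim: (j) => [|i IH]; last first.
    by rewrite big_ord_recr /= augmentationD IH -elX augmentation_el -addn1.
  by rewrite big_ord0 -{1}(subrr (1 : ZG)) augmentationB subrr.
by rewrite augmentation_el rj -muln2.
Qed.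

End Cayley.

Local Close Scope ring_scope.

Theorem theorem2p2p11 (m n : nat) (gT : finGroupType) (a b : gT) (k : nat)
    (hm : 2 <= m) (hn : 4 * n = 2 ^ m)
    (hG : dihedral_presentation n a b) (X Y : alg2complex gT)
    (hX : lmod_iso (pi2 X) (J n a b * 'rV[(intgr gT)^c]_k)%type)
    (hY : lmod_iso (pi2 Y) (J n a b * 'rV[(intgr gT)^c]_k)%type) :
  chain_homotopy_equivalent X Y.
Proof.
have n_gt0 : 0 < n by rewrite -(ltn_pmul2l (m := 4)) // muln0 hn expn_gt0.
have [eps epsE] := cayley_aug_exists gT.
have piC := pi2_cayley k n_gt0 hG.
apply: (@equivalent_of_degrees _ (cayley k n_gt0 hG) eps).
- exact (cayley_aug n_gt0 hG epsE).
- by move=> r s q; apply: cayley_degree.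
- exact: lmod_iso_trans hX (lmod_iso_sym piC).
- exact: lmod_iso_trans piC (lmod_iso_sym hY).
Qed.
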